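(* Let $(\Sigma,\mathcal{P})$ be a weak fan poset, with $\Sigma$ a (simplicial) fan in $\mathbb{R}^n$, and let $\mathfrak{P}_1,\mathfrak{P}_2$ be two admissible partitions of $\Sigma$ such that $\mathfrak{P}_1$ is finer than $\mathfrak{P}_2$. Then the following hold: (1) There exists a faithful surjective-on-objects functor $F:\mathfrak{C}(\Sigma,\mathfrak{P}_1)\to\mathfrak{C}(\Sigma,\mathfrak{P}_2)$. (2) The classifying space $\mathcal{B}\mathfrak{C}(\Sigma,\mathfrak{P}_2)$ is a quotient space of $\mathcal{B}\mathfrak{C}(\Sigma,\mathfrak{P}_1)$. (3) The picture group $G(\Sigma,\mathfrak{P}_2,\mathcal{P})$ is a quotient of the picture group $G(\Sigma,\mathfrak{P}_1,\mathcal{P})$.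
   Context: **Fans.** A cone $\sigma\subseteq\mathbb{R}^n$ means a convex polyhedral cone that is strongly convex and simplicial (generated by linearly independent vectors); $\{0\}$ is a cone. A (simplicial) fan $\Sigma$ in $\mathbb{R}^n$ is a collection of such cones, closed under faces, such that the intersection of two cones of $\Sigma$ is a face of each; it is complete if its union is $\mathbb{R}^n$. $\Sigma^i$ is the set of $i$-dimensional cones. Let $\mathrm{star}(\sigma)=\{\tau\in\Sigma:\sigma\subseteq\tau\}$, $\mathrm{star}(\sigma)^n=\mathrm{star}(\sigma)\cap\Sigma^n$, let $\pi_\sigma:\mathbb{R}^n\to\mathrm{span}\{\sigma\}^\perp$ be the orthogonal projection, and $\pi_\sigma(\mathrm{star}(\sigma))=\{\pi_\sigma(\tau):\tau\in\mathrm{star}(\sigma)\}$. **Admissible partitions.** Let $\mathcal{E}_{\sigma_1}=\{\sigma_2\in\Sigma:\mathrm{span}\{\sigma_1\}^\perp=\mathrm{span}\{\sigma_2\}^\perp,\ \pi_{\sigma_1}(\mathrm{star}(\sigma_1))=\pi_{\sigma_2}(\mathrm{star}(\sigma_2))\}$. Consider a partition $\mathfrak{P}$ of $\Sigma$ each of whose blocks is contained in some $\mathcal{E}_\sigma$; write $\sigma_1\sim\sigma_2$ if they lie in the same block, and $[\sigma]$ for the block of $\sigma$. $\mathfrak{P}$ is admissible if whenever $\sigma_1\sim\sigma_2$ and $\tau_i\in\mathrm{star}(\sigma_i)$ satisfy $\pi_{\sigma_1}(\tau_1)=\pi_{\sigma_2}(\tau_2)$, then $\tau_1\sim\tau_2$.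 $\mathfrak{P}_1$ is finer than $\mathfrak{P}_2$ if $x\sim_{\mathfrak{P}_1}y$ implies $x\sim_{\mathfrak{P}_2}y$. **The category $\mathfrak{C}(\Sigma,\mathfrak{P})$.** Objects are the blocks $[\sigma]$. For $\sigma\subseteq\tau$ let $f_{\sigma\tau}$ be the unique morphism in the poset category $\Sigma$. Morphisms $[\sigma]\to[\tau]$ are equivalence classes $[f_{\sigma_i\tau_j}]$ with $\sigma_i\in[\sigma]$, $\tau_j\in[\tau]$, $\sigma_i\subseteq\tau_j$, where $f_{\sigma_1\tau_1}\sim f_{\sigma_2\tau_2}$ iff $\pi_{\sigma_1}(\tau_1)=\pi_{\sigma_2}(\tau_2)$. Composition: $[f_{\kappa\tau}]\circ[f_{\sigma\kappa}]=[f_{\sigma\tau}]$. The classifying space $\mathcal{B}\mathfrak{C}(\Sigma,\mathfrak{P})$ is the geometric realisation of the nerve. **Weak fan poset.** A weak fan poset $(\Sigma,\mathcal{P})$ consists of a finite complete fan $\Sigma$ in $\mathbb{R}^n$ and a finite poset $\mathcal{P}$ on the set of maximal cones of $\Sigma$ such that: (1) for every $\sigma\in\Sigma$ the set $\mathrm{star}(\sigma)^n$ is an interval of $\mathcal{P}$, denoted $[\sigma^-,\sigma^+]$ (a facial interval); (2) every cover relation $\tau_1\lessdot\tau_2$ in $\mathcal{P}$ is a facial interval $[\sigma^-,\sigma^+]$ for an $(n-1)$-dimensional cone $\sigma=\tau_1\cap\tau_2$. $\mathrm{Hasse}(\mathcal{P})$ has an arrow $\tau_2\to\tau_1$ for each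 cover relation $\tau_1\lessdot\tau_2$, labelled by $\tau_1\cap\tau_2$. **Picture group.** $G(\Sigma,\mathfrak{P},\mathcal{P})$ has generators $X_{[\sigma]}$ for $\sigma\in\Sigma^{n-1}$ (one per block of $\mathfrak{P}$) and relations: (1) $X_{[\sigma_1]}\cdots X_{[\sigma_k]}=X_{[\sigma_1']}\cdots X_{[\sigma_\ell']}$ whenever $(\sigma_1,\dots,\sigma_k)$ and $(\sigma_1',\dots,\sigma_\ell')$ are the ordered label sequences of the arrows of two maximal chains (read along arrows from $\tau_2$ down to $\tau_1$) of an interval $[\tau_1,\tau_2]$ of $\mathcal{P}$; the common element is denoted $X_{[\tau_1,\tau_2]}$; (2) $X_{[\sigma_1^-,\kappa_1^-]}=X_{[\sigma_2^-,\kappa_2^-]}$ whenever $[f_{\sigma_1\kappa_1}]=[f_{\sigma_2\kappa_2}]$ in $\mathfrak{C}(\Sigma,\mathfrak{P})$. *)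

(* Defs.v *)
From HB Require Import structures.
From Stdlib Require Import Relations.
From mathcomp Require Import all_boot all_order all_algebra generic_quotient ring lra.
From mathcomp Require Import all_classical all_reals all_analysis.

Set Implicit Arguments.
Unset Strict Implicit.
Unset Printing Implicit Defensive.

Import Order.TTheory GRing.Theory Num.Theory numFieldNormedType.Exports.
Local Open Scope classical_set_scope.
Local Open Scope ring_scope.
Local Open Scope quotient_scope.

Section Cones.
Context {R : realType} {n : nat}.
Implicit Types (A F s t : set 'rV[R]_n) (S : set (set 'rV[R]_n)).

Definition dotr (u v : 'rV[R]_n) : R := (u *m v^T) 0 0.

Definition cone_of k (B : 'M[R]_(k, n)) : set 'rV[R]_n :=
  [set c *m B | c in [set c : 'rV[R]_k | forall j, 0 <= c 0 j]].

(* Strong convexity is automatic for linearly independent generators;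
   k = 0 gives the cone {0}. *)
Definition is_cone s : Prop :=
  exists k (B : 'M[R]_(k, n)), row_free B /\ s = cone_of B.

Definition is_face F s : Prop :=
  exists u, (forall x, s x -> 0 <= dotr u x) /\
            F = s `&` [set x | dotr u x = 0].

(* The linear span of A, as the row space of a square matrix. *)
Definition lspan A : 'M[R]_n :=
  xget 0 [set V : 'M[R]_n | (forall x, A x -> (x <= V)%MS) /\
     forall W : 'M[R]_n, (forall x, A x -> (x <= W)%MS) -> (V <= W)%MS].

Definition perp (V : 'M[R]_n) : 'M[R]_n := kermx V^T.

(* Projection onto the orthogonal complement of the span, along the span. *)
Definition proj A (x : 'rV[R]_n) : 'rV[R]_n :=
  x *m proj_mx (perp (lspan A)) (lspan A).

Definition cdim s : nat := \rank (lspan s).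

Definition star S s : set (set 'rV[R]_n) := [set t | S t /\ s `<=` t].

Definition proj_star S s : set (set 'rV[R]_n) :=
  [set proj s @` t | t in star S s].

Definition max_cones S : set (set 'rV[R]_n) :=
  [set s | S s /\ forall t, S t -> s `<=` t -> t = s].

Definition star_top S s : set (set 'rV[R]_n) :=
  star S s `&` [set t | cdim t = n].

End Cones.

Record fan (R : realType) (n : nat) := Fan {
  cones :> set (set 'rV[R]_n);
  fan_cone : forall s, cones s -> is_cone s;
  fan_face : forall s F, cones s -> is_face F s -> cones F;
  fan_inter : forall s t, cones s -> cones t ->
    is_face (s `&` t) s /\ is_face (s `&` t) t }.

Definition complete_fan (R : realType) (n : nat) (S : fan R n) : Prop :=
  \bigcup_(s in cones S) s = [set: 'rV[R]_n].

Definition identifiable (R : realType) (n : nat) (S : fan R n)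
    (s1 : set 'rV[R]_n) : set (set 'rV[R]_n) :=
  [set s2 | [/\ cones S s2, (perp (lspan s1) == perp (lspan s2))%MS
              & proj_star S s1 = proj_star S s2]].

Definition same_block T (P : set (set T)) (x y : T) : Prop :=
  exists2 b, P b & b x /\ b y.

Record admissible_partition (R : realType) (n : nat) (S : fan R n) :=
  AdmissiblePartition {
  blocks :> set (set (set 'rV[R]_n));
  blocks_partition : partition blocks id (cones S);
  blocks_identifiable : forall b, blocks b ->
    exists2 s, cones S s & b `<=` identifiable S s;
  blocks_admissible : forall s1 s2 t1 t2, same_block blocks s1 s2 ->
    star S s1 t1 -> star S s2 t2 -> proj s1 @` t1 = proj s2 @` t2 ->
    same_block blocks t1 t2 }.

Definition finer (R : realType) (n : nat) (S : fan R n)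
    (P1 P2 : admissible_partition S) : Prop :=
  forall x y, same_block P1 x y -> same_block P2 x y.

Record category := Category {
  obj : Type;
  hom : obj -> obj -> Type;
  idc : forall a, hom a a;
  compose : forall a b c, hom b c -> hom a b -> hom a c;
  compose_idl : forall a b (f : hom a b), compose (idc b) f = f;
  compose_idr : forall a b (f : hom a b), compose f (idc a) = f;
  compose_assoc : forall a b c d (h : hom c d) (g : hom b c) (f : hom a b),
    compose h (compose g f) = compose (compose h g) f }.
Arguments hom {_} _ _.
Arguments idc {_} a.
Arguments compose {_ a b c} _ _.

Record functor (C D : category) := Functor {
  fobj :> obj C -> obj D;
  fmap : forall a b, hom a b -> hom (fobj a) (fobj b);
  fmap_id : forall a, fmap (idc a) = idc (fobj a);
  fmap_comp : forall a b c (g : hom b c) (f : hom a b),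
    fmap (compose g f) = compose (fmap g) (fmap f) }.
Arguments fmap {C D} _ {a b} _.

Definition faithful C D (F : functor C D) : Prop :=
  forall a b (f g : hom a b), fmap F f = fmap F g -> f = g.

Definition surjective_on_objects C D (F : functor C D) : Prop :=
  forall d, exists c, F c = d.

Definition id_functor C : functor C C :=
  @Functor C C id (fun _ _ f => f) (fun _ => erefl) (fun _ _ _ _ _ => erefl).

Section CompFunctor.
Variables (C D E : category) (G : functor D E) (F : functor C D).

Let map a b (f : hom a b) : hom (G (F a)) (G (F b)) := fmap G (fmap F f).

Lemma comp_functor_id a : map (idc a) = idc (G (F a)).
Proof. by rewrite /map !fmap_id. Qed.

Lemma comp_functor_comp a b c (g : hom b c) (f : hom a b) :
  map (compose g f) = compose (map g) (map f).
Proof. by rewrite /map !fmap_comp. Qed.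

Definition comp_functor : functor C E :=
  @Functor C E (fun a => G (F a)) map comp_functor_id comp_functor_comp.

End CompFunctor.

(* The poset [k] = {0 < ... < k}; functors [l] -> [k] are monotone maps. *)
Definition ord_cat (k : nat) : category :=
  @Category 'I_k.+1 (fun i j => (i <= j)%N : Prop) (fun i => leqnn i)
    (fun i j m jm ij => leq_trans ij jm)
    (fun _ _ _ => bool_irrelevance _ _) (fun _ _ _ => bool_irrelevance _ _)
    (fun _ _ _ _ _ _ _ => bool_irrelevance _ _).

Record sset := SSet {
  simplices :> nat -> Type;
  sact : forall k l, functor (ord_cat l) (ord_cat k) ->
    simplices k -> simplices l;
  sact_id : forall k x, sact (id_functor (ord_cat k)) x = x;
  sact_comp : forall k l m (f : functor (ord_cat l) (ord_cat k))
    (g : functor (ord_cat m) (ord_cat l)) x,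
    sact (comp_functor f g) x = sact g (sact f x) }.
Arguments sact {_ k l} _ _.

Section Nerve.
Variable C : category.

Lemma nerve_id k (x : functor (ord_cat k) C) :
  comp_functor x (id_functor (ord_cat k)) = x.
Proof.
by case: x => o m i c; congr Functor; exact: Prop_irrelevance.
Qed.

Lemma nerve_comp k l m (f : functor (ord_cat l) (ord_cat k))
    (g : functor (ord_cat m) (ord_cat l)) (x : functor (ord_cat k) C) :
  comp_functor x (comp_functor f g) = comp_functor (comp_functor x f) g.
Proof. by congr Functor; exact: Prop_irrelevance. Qed.

Definition nerve : sset :=
  @SSet (fun k => functor (ord_cat k) C) (fun k l f x => comp_functor x f)
    nerve_id nerve_comp.

End Nerve.

Section Realisation.
Variables (R : realType) (X : sset).

Definition std_simplex k : set 'rV[R]_k.+1 :=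
  [set t | (forall i, 0 <= t 0 i) /\ \sum_i t 0 i = 1].

Definition push l k (f : functor (ord_cat l) (ord_cat k)) (t : 'rV[R]_l.+1) :
  'rV[R]_k.+1 := \row_j \sum_(i < l.+1 | (f i : 'I_k.+1) == j) t 0 i.

Definition cell := {classic {k : nat & X k}}.

Definition cell_points (x : cell) : topologicalType :=
  set_type (@std_simplex (projT1 x)).

(* The disjoint union, over all k and x in X_k, of a copy of the simplex. *)
Definition cells : topologicalType := {x : cell & cell_points x}.

(* (f^* x, t) is glued to (x, f_* t). *)
Definition glue (p q : cells) : Prop :=
  exists f : functor (ord_cat (projT1 (projT1 p))) (ord_cat (projT1 (projT1 q))),
    projT2 (projT1 p) = sact f (projT2 (projT1 q)) /\
    set_val (projT2 q) = push f (set_val (projT2 p)).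

Definition glued (p q : cells) : bool := `[< clos_refl_sym_trans cells glue p q >].

Lemma glued_refl : reflexive glued.
Proof. by move=> p; apply/asboolP; exact: rst_refl. Qed.

Lemma glued_sym : symmetric glued.
Proof.
by move=> p q; apply/asboolP/asboolP => ?; exact: rst_sym.
Qed.

Lemma glued_trans : transitive glued.
Proof.
by move=> q p r /asboolP pq /asboolP qr; apply/asboolP; apply: rst_trans qr.
Qed.

Definition glued_equiv := EquivRel glued glued_refl glued_sym glued_trans.

Definition realisation : topologicalType :=
  quotient_topology {eq_quot glued_equiv}.

End Realisation.

Definition classifying_space (R : realType) (C : category) : topologicalType :=
  realisation R (nerve C).

Definition quotient_map (X Y : topologicalType) (q : X -> Y) : Prop :=
  (forall y, exists x, q x = y) /\ forall U : set Y, open U <-> open (q @^-1` U).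

Section Presentation.
Variables (X : Type) (rel : seq X -> seq X -> Prop).

(* (x, false) stands for the generator x, and (x, true) for its inverse. *)
Definition word := {classic seq (X * bool)}.
Definition positive (w : seq X) : seq (X * bool) := [seq (x, false) | x <- w].

Inductive word_eq : seq (X * bool) -> seq (X * bool) -> Prop :=
| word_eq_refl w : word_eq w w
| word_eq_sym w w' : word_eq w w' -> word_eq w' w
| word_eq_trans w w' w'' : word_eq w w' -> word_eq w' w'' -> word_eq w w''
| word_eq_cat u w w' v : word_eq w w' -> word_eq (u ++ w ++ v) (u ++ w' ++ v)
| word_eq_cancel x b : word_eq [:: (x, b); (x, ~~ b)] [::]
| word_eq_rel w w' : rel w w' -> word_eq (positive w) (positive w').

Definition word_eqb (u v : word) : bool := `[< word_eq u v >].

Lemma word_eqb_refl : reflexive word_eqb.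
Proof. by move=> u; apply/asboolP; exact: word_eq_refl. Qed.

Lemma word_eqb_sym : symmetric word_eqb.
Proof. by move=> u v; apply/asboolP/asboolP => /word_eq_sym. Qed.

Lemma word_eqb_trans : transitive word_eqb.
Proof.
by move=> v u w /asboolP uv /asboolP vw; apply/asboolP;
  apply: word_eq_trans uv vw.
Qed.

Definition word_equiv :=
  EquivRel word_eqb word_eqb_refl word_eqb_sym word_eqb_trans.

Definition presented := {eq_quot word_equiv}.
HB.instance Definition _ := Choice.on presented.
HB.instance Definition _ := EqQuotient.on presented.

Definition class_of (w : seq (X * bool)) : presented := \pi_presented (w : word).

Lemma class_ofP u v : class_of u = class_of v <-> word_eq u v.
Proof.
split=> [/eqP|uv]; first by rewrite eqmodE => /asboolP.
by apply/eqP; rewrite eqmodE; apply/asboolP.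
Qed.

Definition repr_word (g : presented) : seq (X * bool) := repr g.

Lemma repr_wordK g : class_of (repr_word g) = g.
Proof. exact: reprK. Qed.

Lemma repr_wordP w : word_eq (repr_word (class_of w)) w.
Proof. by apply/class_ofP; rewrite repr_wordK. Qed.

Definition inv_word (w : seq (X * bool)) : seq (X * bool) :=
  rev [seq (p.1, ~~ p.2) | p <- w].

Definition presented_one : presented := class_of [::].
Definition presented_mul (g h : presented) : presented :=
  class_of (repr_word g ++ repr_word h).
Definition presented_inv (g : presented) : presented :=
  class_of (inv_word (repr_word g)).

Lemma word_eq_cat2 u u' v v' :
  word_eq u u' -> word_eq v v' -> word_eq (u ++ v) (u' ++ v').
Proof.
move=> uu vv; apply: (@word_eq_trans _ (u' ++ v)).
  exact: (@word_eq_cat [::]).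
by have := word_eq_cat u' [::] vv; rewrite !cats0.
Qed.

Lemma presented_mulE u v :
  presented_mul (class_of u) (class_of v) = class_of (u ++ v).
Proof. by apply/class_ofP; apply: word_eq_cat2; exact: repr_wordP. Qed.

Lemma word_eq_invr w : word_eq (w ++ inv_word w) [::].
Proof.
elim: w => [|[x b] w IH]; first exact: word_eq_refl.
rewrite /inv_word /= rev_cons -/(inv_word w) -cats1.
apply: word_eq_trans (word_eq_cancel x b).
have := word_eq_cat [:: (x, b)] [:: (x, ~~ b)] IH.
by rewrite /= -catA.
Qed.

Lemma inv_wordK : involutive inv_word.
Proof.
move=> w; rewrite /inv_word map_rev revK -map_comp -[RHS]map_id.
by apply: eq_map => -[x b] /=; rewrite negbK.
Qed.

Lemma word_eq_invl w : word_eq (inv_word w ++ w) [::].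
Proof. by rewrite -{2}[w]inv_wordK; exact: word_eq_invr. Qed.

Lemma presented_mulA : associative presented_mul.
Proof.
move=> g h k; rewrite -[g]repr_wordK -[h]repr_wordK -[k]repr_wordK.
by rewrite !presented_mulE catA.
Qed.

Lemma presented_mul1 : left_id presented_one presented_mul.
Proof. by move=> g; rewrite -[g]repr_wordK presented_mulE. Qed.

Lemma presented_mulr1 : right_id presented_one presented_mul.
Proof. by move=> g; rewrite -[g]repr_wordK presented_mulE cats0. Qed.

Lemma presented_mulV : left_inverse presented_one presented_inv presented_mul.
Proof.
move=> g; rewrite -{2}[g]repr_wordK presented_mulE.
by apply/class_ofP; exact: word_eq_invl.
Qed.

Lemma presented_mulrV : right_inverse presented_one presented_inv presented_mul.
Proof.
move=> g; rewrite -{1}[g]repr_wordK presented_mulE.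
by apply/class_ofP; exact: word_eq_invr.
Qed.

HB.instance Definition _ := isGroup.Build presented presented_mulA
  presented_mul1 presented_mulr1 presented_mulV presented_mulrV.

End Presentation.

Section ConeTheory.
Context {R : realType} {n : nat}.
Implicit Types (A : set 'rV[R]_n) (V W : 'M[R]_n) (x y u : 'rV[R]_n).

Lemma dotrE u x : dotr u x = \sum_i u 0 i * x 0 i.
Proof. by rewrite /dotr mxE; apply: eq_bigr => i _; rewrite mxE. Qed.

Lemma dotrDr u x y : dotr u (x + y) = dotr u x + dotr u y.
Proof. by rewrite /dotr linearD /= mulmxDr mxE. Qed.

Lemma dotr_eq0 x : dotr x x = 0 -> x = 0.
Proof.
rewrite dotrE => /eqP; rewrite psumr_eq0 => [/allP x0|i _]; last first.
  by rewrite -expr2 sqr_ge0.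
apply/rowP => i; rewrite mxE; apply/eqP.
by have := x0 i (mem_index_enum i); rewrite mulf_eq0 orbb.
Qed.

Lemma dotr_mulmx k u (c : 'rV[R]_k) (B : 'M[R]_(k, n)) :
  dotr u (c *m B) = \sum_j c 0 j * dotr u (row j B).
Proof.
rewrite /dotr trmx_mul mulmxA mxE; apply: eq_bigr => j _.
rewrite mulrC ![in LHS]mxE [in RHS]mxE; congr (_ * _).
by apply: eq_bigr => i _; rewrite !mxE.
Qed.

Lemma perp_cap V : (perp V :&: V)%MS = 0.
Proof.
apply/eqP/rowV0P => x; rewrite sub_capmx => /andP[/sub_kermxP xV /submxP[c xc]].
by apply: dotr_eq0; rewrite /dotr {2}xc trmx_mul mulmxA xV mul0mx mxE.
Qed.

Lemma rank_perp V : \rank (perp V) = (n - \rank V)%N.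
Proof. by rewrite mxrank_ker mxrank_tr. Qed.

Lemma sub_perp_span V x : (x <= perp V + V)%MS.
Proof.
apply: submx_full; rewrite -col_leq_rank.
by rewrite mxrank_disjoint_sum ?perp_cap // rank_perp subnK // rank_leq_col.
Qed.

Lemma perpK V : (perp (perp V) :=: V)%MS.
Proof.
apply/eqmx_sym/eqmxP.
have sV : (V <= perp (perp V))%MS.
  by apply/sub_kermxP; rewrite -[V in V *m _]trmxK -trmx_mul mulmx_ker trmx0.
by rewrite -(geq_leqif (mxrank_leqif_eq sV)) !rank_perp subKn // rank_leq_col.
Qed.

Lemma perp_inj V W : (perp V == perp W)%MS -> (V :=: W)%MS.
Proof.
have sub V1 V2 : (perp V1 <= perp V2)%MS -> (V2 <= V1)%MS.
  move=> /sub_kermxP s12; rewrite -(perpK V1); apply/sub_kermxP.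
  by rewrite -[V2]trmxK -trmx_mul s12 trmx0.
by case/andP => *; apply/eqmxP/andP; split; exact: sub.
Qed.

Lemma lspan_cone k (B : 'M[R]_(k, n)) : (lspan (cone_of B) :=: B)%MS.
Proof.
rewrite /lspan; set Q := [set V : 'M[R]_n | _].
have QB : Q <<B>>%MS.
  split=> [_ [c _ <-]|W sW]; first by rewrite genmxE submxMl.
  rewrite genmxE; apply/row_subP => i; apply: sW; exists (delta_mx 0 i).
    by move=> j; rewrite mxE; case: (_ && _).
  by rewrite -rowE.
have [sub mini] : Q (xget 0 Q) by apply: xgetPex; exists <<B>>%MS.
case: QB => subB miniB.
apply/eqmxP/andP; split; first by have := mini _ subB; rewrite genmxE.
by have := miniB _ sub; rewrite genmxE.
Qed.

Lemma lspan_mono A1 A2 : is_cone A1 -> is_cone A2 -> A1 `<=` A2 ->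
  (lspan A1 <= lspan A2)%MS.
Proof.
move=> [k [B [_ ->]]] [l [C [_ ->]]] sub; rewrite !lspan_cone.
apply/row_subP => i; have [|c _ <-] := sub (row i B); last exact: submxMl.
exists (delta_mx 0 i); last by rewrite -rowE.
by move=> j; rewrite mxE; case: (_ && _).
Qed.

Lemma projE0 A x : (x <= lspan A)%MS -> proj A x = 0.
Proof. exact/proj_mx_0/perp_cap. Qed.

Lemma proj_span A x : (x - proj A x <= lspan A)%MS.
Proof. exact/proj_mx_compl_sub/sub_perp_span. Qed.

Lemma projB A x y : proj A (x - y) = proj A x - proj A y.
Proof. exact: mulmxBl. Qed.

Lemma eq_proj_span A x y : proj A x = proj A y -> (x - y <= lspan A)%MS.
Proof.
move=> xy; have -> : x - y = (x - proj A x) - (y - proj A y).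
  by rewrite xy; apply/rowP => i; rewrite !mxE; ring.
by rewrite addmx_sub ?eqmx_opp ?proj_span.
Qed.

Lemma proj_sub A1 A2 x : (lspan A1 <= lspan A2)%MS ->
  proj A2 (proj A1 x) = proj A2 x.
Proof.
move=> s12; apply/eqP; rewrite eq_sym -subr_eq0 -projB projE0 //.
exact: submx_trans (proj_span A1 x) s12.
Qed.

Lemma eq_proj A1 A2 : (lspan A1 :=: lspan A2)%MS -> proj A1 =1 proj A2.
Proof.
move=> e x; rewrite -(@proj_sub A2 A1) ?e //.
apply: proj_mx_id; first exact: perp_cap.
have /submxP[D eD] : (lspan A1 <= lspan A2)%MS by rewrite e.
apply/sub_kermxP; rewrite {}eD trmx_mul mulmxA.
by move: (proj_mx_sub (perp (lspan A2)) (lspan A2) x) => /sub_kermxP ->;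
  rewrite mul0mx.
Qed.

End ConeTheory.

Section FanTheory.
Context {R : realType} {n : nat} (S : fan R n).
Implicit Types s t k : set 'rV[R]_n.

Lemma cone_ofD l (B : 'M[R]_(l, n)) x y :
  cone_of B x -> cone_of B y -> cone_of B (x + y).
Proof.
move=> [c c0 <-] [d d0 <-]; exists (c + d); last by rewrite mulmxDl.
by move=> j; rewrite mxE addr_ge0.
Qed.

Lemma star_proj_sub s k t : cones S s -> star S s k -> star S s t ->
  proj s @` k `<=` proj s @` t -> k `<=` t.
Proof.
move=> Ss [Sk sk] [St st] sub.
have [ls [B [_ Bs]]] := fan_cone Ss; have [lk [C [_ Ck]]] := fan_cone Sk.
have [lt [D [_ Dt]]] := fan_cone St.
pose x := const_mx 1 *m C : 'rV[R]_n.
have kx : k x by rewrite Ck; exists (const_mx 1) => // j; rewrite mxE.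
have [z tz zx] : (proj s @` t) (proj s x) by apply: sub; exists x.
have /submxP[c xzc] : (x - z <= B)%MS.
  by have := eq_proj_span (esym zx); rewrite Bs lspan_cone.
pose cp := \row_j Num.max (c 0 j) 0; pose cn := \row_j Num.max (- c 0 j) 0.
have ccpn : c = cp - cn.
  by apply/rowP => j; rewrite !mxE; case: (leP (c 0 j) 0); case: (leP (- c 0 j) 0); lra.
have s_cp : s (cp *m B).
  by rewrite Bs; exists cp => // j; rewrite mxE le_max lexx orbT.
have s_cn : s (cn *m B).
  by rewrite Bs; exists cn => // j; rewrite mxE le_max lexx orbT.
have [d d0 dE] : cone_of C (cn *m B) by rewrite -Ck; exact: sk.
pose y := x + cn *m B.
have ty : t y.
  rewrite (_ : y = z + cp *m B); last first.
    have -> : cp = c + cn by rewrite ccpn subrK.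
    by rewrite mulmxDl -xzc /y addrA addrCA subrr addr0.
  by rewrite Dt; apply: cone_ofD; rewrite -Dt //; exact: st.
have yE : y = (const_mx 1 + d) *m C by rewrite mulmxDl dE.
have [[u [u0 kt]] _] := fan_inter Sk St.
have [_ uy] : (k `&` [set x | dotr u x = 0]) y.
  by rewrite -kt; split=> //; rewrite Ck yE; exists (const_mx 1 + d) => // j;
    rewrite !mxE addr_ge0.
have uC j : dotr u (row j C) = 0.
  have uC0 i : 0 <= dotr u (row i C).
    apply: u0; rewrite Ck; exists (delta_mx 0 i); last by rewrite -rowE.
    by move=> i'; rewrite mxE; case: (_ && _).
  move: uy; rewrite yE /= dotr_mulmx => /eqP; rewrite psumr_eq0; last first.
    by move=> i _; rewrite mulr_ge0 // !mxE addr_ge0.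
  move=> /allP/(_ j (mem_index_enum j)); rewrite mulf_eq0 !mxE => /orP[|/eqP//].
  by rewrite gt_eqF // ltr_pwDl.
move=> w kw; suff [] : (k `&` t) w by [].
rewrite kt; split=> //=; move: kw; rewrite Ck => -[e _ <-].
by rewrite dotr_mulmx big1 // => j _; rewrite uC mulr0.
Qed.

Lemma star_proj_inj s k t : cones S s -> star S s k -> star S s t ->
  proj s @` k = proj s @` t -> k = t.
Proof.
move=> Ss sk st e; apply/seteqP; split.
  by apply: star_proj_sub Ss sk st _; rewrite e.
by apply: star_proj_sub Ss st sk _; rewrite e.
Qed.

Lemma image_proj_sub s k A : cones S s -> cones S k -> s `<=` k ->
  proj k @` A = proj k @` (proj s @` A).
Proof.
move=> Ss Sk sk; rewrite image_comp; apply: eq_imagel => x _ /=.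
by rewrite proj_sub //; exact: lspan_mono (fan_cone Ss) (fan_cone Sk) sk.
Qed.

Section Partition.
Variable P : admissible_partition S.
Local Notation sim := (same_block P).

Lemma sim_cone s t : sim s t -> cones S s.
Proof.
by case: (blocks_partition P) => <- _ _ [b Pb [bs _]]; exists b.
Qed.

Lemma sim_refl s : cones S s -> sim s s.
Proof.
by case: (blocks_partition P) => <- _ _ [b Pb bs]; exists b.
Qed.

Lemma sim_sym s t : sim s t -> sim t s.
Proof. by case=> b Pb [bs bt]; exists b. Qed.

Lemma block_eq b c s : blocks P b -> blocks P c -> b s -> c s -> b = c.
Proof.
case: (blocks_partition P) => _ triv _ Pb Pc bs cs.
by apply: triv => //; exists s.
Qed.

Lemma sim_block b s t : blocks P b -> b s -> sim s t <-> b t.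
Proof.
move=> Pb bs; split=> [[c Pc [cs ct]]|bt]; last by exists b.
by rewrite (block_eq Pb Pc bs cs).
Qed.

Lemma sim_trans s t k : sim s t -> sim t k -> sim s k.
Proof. by case=> b Pb [bs bt] /(sim_block _ Pb bt) bk; exists b. Qed.

Lemma sim_identifiable s t : sim s t ->
  (lspan s :=: lspan t)%MS /\ proj_star S s = proj_star S t.
Proof.
case=> b Pb [bs bt]; have [k _ sub] := blocks_identifiable Pb.
have [_ /perp_inj ks ks'] := sub _ bs; have [_ /perp_inj kt kt'] := sub _ bt.
split; last by rewrite -ks' -kt'.
exact: eqmx_trans (eqmx_sym ks) kt.
Qed.

Lemma lift_star s1 s2 t1 : sim s1 s2 -> star S s1 t1 ->
  exists t2, [/\ star S s2 t2, proj s1 @` t1 = proj s2 @` t2 & sim t1 t2].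
Proof.
move=> s12 st1; have [_ e] := sim_identifiable s12.
have [t2 st2 t12] : proj_star S s2 (proj s1 @` t1) by rewrite -e; exists t1.
exists t2; split; [exact: st2|exact: esym|].
exact: blocks_admissible s12 st1 st2 (esym t12).
Qed.

Lemma proj_flag s1 s2 k1 k2 t1 t2 : sim s1 s2 -> sim k1 k2 ->
  star S s1 k1 -> star S s2 k2 -> star S k1 t1 -> star S k2 t2 ->
  proj s1 @` k1 = proj s2 @` k2 -> proj k1 @` t1 = proj k2 @` t2 ->
  proj s1 @` t1 = proj s2 @` t2.
Proof.
move=> s12 k12 sk1 sk2 kt1 kt2 es ek.
have Ss1 := sim_cone s12; have Ss2 := sim_cone (sim_sym s12).
have st1 : star S s1 t1.
  by split; [case: kt1|exact: subset_trans sk1.2 kt1.2].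
have st2 : star S s2 t2.
  by split; [case: kt2|exact: subset_trans sk2.2 kt2.2].
have [t [st t1t _]] := lift_star s12 st1.
have k2t : star S k2 t.
  split; first by case: st.
  apply: (star_proj_sub Ss2 sk2 st); rewrite -es -t1t.
  by apply: image_subset; case: kt1.
rewrite t1t; congr (_ @` _); apply: (star_proj_inj _ k2t kt2).
  by case: sk2.
rewrite (image_proj_sub _ Ss2 sk2.1 sk2.2) -t1t -ek.
rewrite (image_proj_sub _ Ss1 sk1.1 sk1.2).
apply: eq_imagel => x _; apply: eq_proj.
by case: (sim_identifiable (sim_sym k12)).
Qed.

(* The class of the morphism f_{s t} of the poset S, encoded as the set of the
   pairs (s', t') with f_{s' t'} equivalent to f_{s t}. *)
Definition mor_class s t : set (set 'rV[R]_n * set 'rV[R]_n) :=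
  [set p | [/\ sim s p.1, sim t p.2, p.1 `<=` p.2
              & proj p.1 @` p.2 = proj s @` t]].

Definition fan_obj := {b : set (set 'rV[R]_n) | blocks P b}.

Definition fan_hom (a b : fan_obj) :=
  {m : set (set 'rV[R]_n * set 'rV[R]_n) |
    exists s t, [/\ sval a s, sval b t, s `<=` t & m = mor_class s t]}.

Definition fan_mor (a b : fan_obj) s t (sa : sval a s) (tb : sval b t)
    (st : s `<=` t) : fan_hom a b :=
  exist _ (mor_class s t) (ex_intro _ s (ex_intro _ t (And4 sa tb st erefl))).

Lemma fan_hom_eq a b (f g : fan_hom a b) : sval f = sval g -> f = g.
Proof. exact: eq_sig_hprop. Qed.

Lemma obj_cone (a : fan_obj) s : sval a s -> cones S s.
Proof. by move=> sa; apply: (@sim_cone s s); exists (sval a) => //; exact: svalP. Qed.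

Lemma obj_sim (a : fan_obj) s t : sval a s -> sval a t -> sim s t.
Proof. by move=> sa ta; exists (sval a) => //; exact: svalP. Qed.

Lemma sim_obj (a : fan_obj) s t : sval a s -> sim s t -> sval a t.
Proof. by move=> sa /(sim_block _ (svalP a) sa). Qed.

Lemma mor_class_refl s t : cones S s -> cones S t -> s `<=` t ->
  mor_class s t (s, t).
Proof. by move=> Ss St st; split=> //; exact: sim_refl. Qed.

Lemma mor_class_eq s1 t1 s2 t2 : sim s1 s2 -> sim t1 t2 ->
  proj s1 @` t1 = proj s2 @` t2 -> mor_class s1 t1 = mor_class s2 t2.
Proof.
have sub s t s' t' : sim s s' -> sim t t' -> proj s @` t = proj s' @` t' ->
    mor_class s t `<=` mor_class s' t'.
  move=> ss tt e p [sp tp inc e']; split; last exact: etrans e' e.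
  - exact: sim_trans (sim_sym ss) sp.
  - exact: sim_trans (sim_sym tt) tp.
  - exact: inc.
move=> s12 t12 e; apply/seteqP; split; apply: sub => //; exact: sim_sym.
Qed.

Lemma fan_hom_repr a b (f : fan_hom a b) s : sval a s ->
  exists t (tb : sval b t) (sa : sval a s) (st : s `<=` t), f = fan_mor sa tb st.
Proof.
move=> sa; have [s' [t' [sa' tb' st' fE]]] := svalP f.
have [t [[_ st] e tt]] :=
  lift_star (obj_sim sa' sa) (conj (obj_cone tb') st' : star S s' t').
exists t, (sim_obj tb' tt), sa, st; apply: fan_hom_eq; rewrite fE /=.
by apply: mor_class_eq => //; exact: obj_sim sa' sa.
Qed.

(* [f_{k t}] o [f_{s k}] = [f_{s t}], see fan_comp_mor *)
Definition fan_comp_set a b c (g : fan_hom b c) (f : fan_hom a b) :=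
  [set p | exists s k t,
    [/\ sval f (s, k), sval g (k, t) & mor_class s t p]].

Lemma fan_comp_setE (a b c : fan_obj) s k t (sa : sval a s) (kb : sval b k)
    (tc : sval c t) (sk : s `<=` k) (kt : k `<=` t) :
  fan_comp_set (fan_mor kb tc kt) (fan_mor sa kb sk) = mor_class s t.
Proof.
have [Ss Sk St] := And3 (obj_cone sa) (obj_cone kb) (obj_cone tc).
apply/seteqP; split=> p; last first.
  by move=> stp; exists s, k, t; split=> //; exact: mor_class_refl.
move=> [s' [k' [t' [[/= ss kk sk' e] [/= _ tt kt' e'] stp]]]].
suff <- : mor_class s' t' = mor_class s t by [].
have [Sk' St'] := (sim_cone (sim_sym kk), sim_cone (sim_sym tt)).
apply: mor_class_eq; [exact: sim_sym|exact: sim_sym|].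
apply: (proj_flag (sim_sym ss) (sim_sym kk) _ _ _ _ e e'); by split.
Qed.

Lemma fan_comp_subproof a b c (g : fan_hom b c) (f : fan_hom a b) :
  exists s t, [/\ sval a s, sval c t, s `<=` t
                 & fan_comp_set g f = mor_class s t].
Proof.
have [s [_ [sa _ _ _]]] := svalP f.
have [k [kb [sa' [sk ->]]]] := fan_hom_repr f sa.
have [t [tc [kb' [kt ->]]]] := fan_hom_repr g kb.
exists s, t; rewrite (Prop_irrelevance kb' kb) fan_comp_setE.
by split=> //; exact: subset_trans kt.
Qed.

Definition fan_comp a b c (g : fan_hom b c) (f : fan_hom a b) : fan_hom a c :=
  exist _ (fan_comp_set g f) (fan_comp_subproof g f).

Lemma fan_comp_mor (a b c : fan_obj) s k t (sa : sval a s) (kb : sval b k)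
    (tc : sval c t) (sk : s `<=` k) (kt : k `<=` t) :
  fan_comp (fan_mor kb tc kt) (fan_mor sa kb sk) =
  fan_mor sa tc (subset_trans sk kt).
Proof. by apply: fan_hom_eq; rewrite /= fan_comp_setE. Qed.

Lemma fan_obj_inhab (a : fan_obj) : exists s, sval a s.
Proof. by case: a => b Pb; case: (blocks_partition P) => _ _ /(_ b Pb). Qed.

Lemma mor_class_id s t : sim s t -> mor_class s s = mor_class t t.
Proof.
move=> st; apply: mor_class_eq => //.
have zero k : cones S k -> proj k @` k = [set 0].
  move=> Sk; have [l [B [_ e]]] := fan_cone Sk; apply/seteqP; split=> [_ [x kx <-]|_ ->].
    apply: projE0; move: kx; rewrite [in k x]e => -[c _ <-].
    by rewrite e lspan_cone submxMl.
  exists 0; last by rewrite projE0 ?sub0mx.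
  by rewrite e; exists 0; rewrite ?mul0mx // => j; rewrite mxE.
by rewrite (zero _ (sim_cone st)) (zero _ (sim_cone (sim_sym st))).
Qed.

Definition fan_id_set (a : fan_obj) : set (set 'rV[R]_n * set 'rV[R]_n) :=
  [set p | exists2 s, sval a s & mor_class s s p].

Lemma fan_id_setE (a : fan_obj) s : sval a s -> fan_id_set a = mor_class s s.
Proof.
move=> sa; apply/seteqP; split=> [p [s' sa']|p]; last by exists s.
by rewrite (mor_class_id (obj_sim sa' sa)).
Qed.

Lemma fan_id_subproof (a : fan_obj) :
  exists s t, [/\ sval a s, sval a t, s `<=` t & fan_id_set a = mor_class s t].
Proof.
have [s sa] := fan_obj_inhab a; exists s, s; split=> //.
exact: fan_id_setE.
Qed.

Definition fan_id (a : fan_obj) : fan_hom a a :=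
  exist _ (fan_id_set a) (fan_id_subproof a).

Lemma fan_id_mor (a : fan_obj) s (sa : sval a s) :
  fan_id a = fan_mor sa sa (@subset_refl _ s).
Proof. by apply: fan_hom_eq; exact: fan_id_setE. Qed.

Lemma fan_comp_idl a b (f : fan_hom a b) : fan_comp (fan_id b) f = f.
Proof.
have [s sa] := fan_obj_inhab a; have [t [tb [sa' [st ->]]]] := fan_hom_repr f sa.
by rewrite (fan_id_mor tb) fan_comp_mor; exact: fan_hom_eq.
Qed.

Lemma fan_comp_idr a b (f : fan_hom a b) : fan_comp f (fan_id a) = f.
Proof.
have [s sa] := fan_obj_inhab a; have [t [tb [sa' [st ->]]]] := fan_hom_repr f sa.
by rewrite (fan_id_mor sa') fan_comp_mor; exact: fan_hom_eq.
Qed.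

Lemma fan_comp_assoc a b c d (h : fan_hom c d) (g : fan_hom b c)
    (f : fan_hom a b) : fan_comp h (fan_comp g f) = fan_comp (fan_comp h g) f.
Proof.
have [s sa] := fan_obj_inhab a; have [t [tb [sa' [st ->]]]] := fan_hom_repr f sa.
have [k [kc [tb' [tk ->]]]] := fan_hom_repr g tb.
have [l [ld [kc' [kl ->]]]] := fan_hom_repr h kc.
rewrite (Prop_irrelevance tb' tb) (Prop_irrelevance kc' kc) !fan_comp_mor.
exact: fan_hom_eq.
Qed.

Definition fan_category : category :=
  Category fan_comp_idl fan_comp_idr fan_comp_assoc.

End Partition.
End FanTheory.

Section FanPosetDefs.
Context {R : realType} {n : nat} (S : fan R n).
Variable le : set 'rV[R]_n -> set 'rV[R]_n -> Prop.
Implicit Types s t : set 'rV[R]_n.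

Definition facial_interval s t1 t2 : Prop :=
  le t1 t2 /\ star_top S s = [set t | le t1 t /\ le t t2].

Definition covers t1 t2 : Prop :=
  [/\ le t1 t2, t1 <> t2 & forall t, le t1 t -> le t t2 -> t = t1 \/ t = t2].

End FanPosetDefs.

Record weak_fan_poset (R : realType) (n : nat) (S : fan R n) := WeakFanPoset {
  fple : set 'rV[R]_n -> set 'rV[R]_n -> Prop;
  fple_max : forall s t, fple s t -> max_cones S s /\ max_cones S t;
  fple_refl : forall s, max_cones S s -> fple s s;
  fple_anti : forall s t, fple s t -> fple t s -> s = t;
  fple_trans : forall s t u, fple s t -> fple t u -> fple s u;
  fan_finite : finite_set (cones S);
  fan_complete : complete_fan S;
  star_facial : forall s, cones S s -> exists t1 t2, facial_interval S fple s t1 t2;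
  cover_facial : forall t1 t2, covers fple t1 t2 ->
    [/\ cones S (t1 `&` t2), (cdim (t1 `&` t2)).+1 = n
      & facial_interval S fple (t1 `&` t2) t1 t2] }.

Section PictureGroup.
Context {R : realType} {n : nat} (S : fan R n).
Variables (P : admissible_partition S) (Q : weak_fan_poset S).
Implicit Types s t k : set 'rV[R]_n.

(* hasse_path t2 t1 l: l is the label sequence of a directed path from t2 down
   to t1 in the Hasse quiver, i.e. of a maximal chain of [t1, t2]. *)
Inductive hasse_path : set 'rV[R]_n -> set 'rV[R]_n ->
    seq (set 'rV[R]_n) -> Prop :=
| hasse_nil t : max_cones S t -> hasse_path t t [::]
| hasse_cons t3 t2 t1 l : covers (fple Q) t2 t3 -> hasse_path t2 t1 l ->
    hasse_path t3 t1 (t2 `&` t3 :: l).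

Definition block_of s : set (set 'rV[R]_n) := [set t | same_block P s t].

Definition picture_gen :=
  {b : set (set 'rV[R]_n) | blocks P b /\ exists2 s, b s & (cdim s).+1 = n}.

(* The word w is X_[s_1] ... X_[s_k], where l = (s_1, ..., s_k). *)
Definition spells (w : seq picture_gen) (l : seq (set 'rV[R]_n)) : Prop :=
  [seq sval x | x <- w] = [seq block_of s | s <- l].

(* The word w is a value of X_[t1, t2]. *)
Definition chain_word t1 t2 (w : seq picture_gen) : Prop :=
  exists2 l, hasse_path t2 t1 l & spells w l.

(* t is the minimum s^- of star(s)^n. *)
Definition facial_min s t : Prop :=
  exists t', facial_interval S (fple Q) s t t'.

Inductive picture_rel : seq picture_gen -> seq picture_gen -> Prop :=
| picture_chain t1 t2 w w' : chain_word t1 t2 w -> chain_word t1 t2 w' ->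
    picture_rel w w'
| picture_mor s1 k1 s2 k2 s1m k1m s2m k2m w w' :
    star S s1 k1 -> star S s2 k2 -> cones S s1 -> cones S s2 ->
    mor_class P s1 k1 = mor_class P s2 k2 ->
    facial_min s1 s1m -> facial_min k1 k1m ->
    facial_min s2 s2m -> facial_min k2 k2m ->
    chain_word s1m k1m w -> chain_word s2m k2m w' -> picture_rel w w'.

Definition picture_group : groupType := presented picture_rel.

End PictureGroup.

(* Main.v *)
From HB Require Import structures.
Require Import Defs.
From mathcomp Require Import all_boot all_order all_algebra.
From mathcomp Require Import all_classical all_reals all_analysis.

(** Passing from a partition P1 to a coarser one P2 sends each block of P1 to
    the block of P2 containing it and the class of f_{s t} for P1 to the class
    of f_{s t} for P2. Both classes are cut out by the same condition on
    projections, which admissibility makes compatible with composition, so this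
    is a functor F; it is onto on objects because a block of P2 contains a cone,
    and the P1-block of that cone is mapped to it. The rest is about why F is
    faithful and why it induces quotients.

    Faithfulness. Every morphism out of a block can be written f_{s t} with a
    prescribed representative s of the source, and once s is fixed the cone t is
    determined by the morphism, because projection along s is injective on the
    star of s ([mor_class_target_inj]). This holds for every admissible
    partition, so two morphisms with equal images have, over a common s, the
    same t already.

    Classifying spaces. The same rigidity shows that every simplex of the nerve
    of such a category comes from a chain s_0 <= ... <= s_k of cones of the fan
    ([nerve_chain]): choose s_0 in the first block, let s_i be the target of the
    composite morphism from block 0 to block i, and the morphism from block i to
    block j is then forced to be the class of f_{s_i s_j}. Chains of cones do not
    depend on the partition, and F maps the simplex of a chain for P1 to the
    simplex of the same chain for P2. So F is surjective on nerves in every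
    dimension. A levelwise surjective simplicial map induces a quotient map
    between the disjoint unions of simplices, since it maps each simplex
    identically onto another, and hence a quotient map between the realisations
    ([realisation_map_quotient]).

    Picture groups. Send X_[s] for P1 to X_[s] for P2. The chain relations are
    indexed by the cones and the poset only, and an equality of morphism classes
    for P1 implies the one for P2, so each relation is mapped to a relation
    ([picture_rel_coarse]). Every generator is hit, hence so is every element. *)

(** * Quotient maps of topological spaces *)

Section QuotientMaps.
Local Open Scope classical_set_scope.

Lemma quotient_map_comp (X Y Z : topologicalType) (p : X -> Y) (q : Y -> Z) :
  quotient_map p -> quotient_map q -> quotient_map (q \o p).
Proof.
move=> [surp openp] [surq openq]; split=> [z|U]; last by rewrite openq openp.
have [y <-] := surq z; have [x <-] := surp y.
by exists x.
Qed.

Lemma quotient_map_factor (X Y Z : topologicalType) (p : X -> Y) (q : Y -> Z) :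
  quotient_map p -> quotient_map (q \o p) -> quotient_map q.
Proof.
move=> [surp openp] [surqp openqp]; split=> [z|U].
  by have [x <-] := surqp z; exists (p x).
by rewrite openqp openp.
Qed.

End QuotientMaps.

(** * Geometric realisation of a levelwise surjective simplicial map *)

Section RealisationMap.
Set Implicit Arguments.
Unset Strict Implicit.
Local Open Scope classical_set_scope.
Local Open Scope quotient_scope.
Variables (R : realType) (X Y : sset) (phi : forall k, X k -> Y k).
Hypothesis phi_natural : forall k l (f : functor (ord_cat l) (ord_cat k)) x,
  phi (sact f x) = sact f (phi x).
Hypothesis phi_surj : forall k (y : Y k), exists x, phi x = y.

(** The projection of the disjoint union of simplices onto the realisation. *)
Definition glue_class (Z : sset) (p : cells R Z) : realisation R Z :=
  \pi_(quotient_topology {eq_quot (glued_equiv R Z)}) p.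

Lemma glue_class_eq Z (p q : cells R Z) :
  glue_class p = glue_class q <->
  Relations.Relation_Operators.clos_refl_sym_trans _ (@Defs.glue R Z) p q.
Proof.
transitivity (p = q %[mod {eq_quot (glued_equiv R Z)}]); first by [].
split=> [/eqP|pq]; first by rewrite eqmodE => /asboolP.
by apply/eqP; rewrite eqmodE; apply/asboolP.
Qed.

(** The realisation carries the quotient topology, so its open sets are by
    definition those with open preimage among the cells. *)
Lemma glue_class_quotient Z : quotient_map (@glue_class Z).
Proof. by split=> [y|U //]; exists (repr y); exact: reprK. Qed.

Definition cell_map (x : cell X) : cell Y :=
  existT _ (projT1 x) (phi (projT2 x)).

Definition cells_map (p : cells R X) : cells R Y :=
  existT (cell_points R (X:=Y)) (cell_map (projT1 p)) (projT2 p).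

(** Defined on a chosen cell representative; [realisation_map_class] shows that
    the choice does not matter. *)
Definition realisation_map (p : realisation R X) : realisation R Y :=
  glue_class (cells_map (repr p)).

(** Naturality of phi sends an elementary gluing of cells to an elementary
    gluing along the same monotone map, hence the generated equivalence relation
    to the corresponding one. *)
Lemma realisation_map_class p :
  realisation_map (glue_class p) = glue_class (cells_map p).
Proof.
have : glue_class (repr (glue_class p)) = glue_class p by exact: reprK.
rewrite /realisation_map; move: (repr _) => q /glue_class_eq qp.
apply/glue_class_eq.
elim: qp => {p q}.
- move=> p q [f [xE tE]]; apply: Relation_Operators.rst_step; exists f; split=> //=.
  by rewrite xE phi_natural.
- by move=> p; exact: Relation_Operators.rst_refl.
- by move=> p q _; exact: Relation_Operators.rst_sym.
- by move=> p q r _ pq _; exact: Relation_Operators.rst_trans.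
Qed.

(** The map is the identity from the simplex of x onto the simplex of phi x, and
    every simplex of the target is reached because phi is surjective. *)
Lemma cells_map_quotient : quotient_map cells_map.
Proof.
split=> [[[k y] t]|U].
  have [x <-] := phi_surj y.
  by exists (existT (cell_points R (X:=X)) (existT _ k x) t).
(* A set of cells is open when its trace on each simplex is, and the trace of
   the preimage of U on the simplex of x is the trace of U on that of phi x. *)
rewrite !sigT_openP; split=> openU [k y].
  exact: openU (existT _ k (phi y)).
have [x <-] := phi_surj y.
exact: openU (existT _ k x).
Qed.

(** Up to the projections from the disjoint unions of simplices, which are
    quotient maps, the map of realisations is the map of cells. *)
Lemma realisation_map_quotient : quotient_map realisation_map.
Proof.
apply: quotient_map_factor (glue_class_quotient X) _.
have -> : realisation_map \o @glue_class X = @glue_class Y \o cells_map.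
  by apply/funext => p; exact: realisation_map_class.
exact: quotient_map_comp cells_map_quotient (glue_class_quotient Y).
Qed.

End RealisationMap.

(** * Maps between presented groups *)

Section PresentedMap.
Set Implicit Arguments.
Unset Strict Implicit.
Variables (X Y : Type) (relX : seq X -> seq X -> Prop).
Variables (relY : seq Y -> seq Y -> Prop) (g : X -> Y).
Hypothesis g_rel : forall w w', relX w w' -> relY (map g w) (map g w').

Definition letter_map (p : X * bool) : Y * bool := (g p.1, p.2).

Lemma word_eq_map u v : word_eq relX u v ->
  word_eq relY (map letter_map u) (map letter_map v).
Proof.
elim=> {u v}.
- by move=> w; exact: word_eq_refl.
- by move=> w w' _; exact: word_eq_sym.
- by move=> u v w _ uv _; exact: word_eq_trans.
- by move=> u w w' v _ ww'; rewrite !map_cat; exact: word_eq_cat.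
- by move=> x b; exact: word_eq_cancel.
- move=> w w' /g_rel/word_eq_rel.
  by rewrite /positive -!map_comp.
Qed.

Definition presented_map (a : presented relX) : presented relY :=
  class_of relY (map letter_map (repr_word a)).

Lemma presented_map_class w :
  presented_map (class_of relX w) = class_of relY (map letter_map w).
Proof. by apply/class_ofP/word_eq_map; exact: repr_wordP. Qed.

Lemma presented_map_mul : {morph presented_map : a b / (a * b)%g}.
Proof.
move=> a b; rewrite -[a]repr_wordK -[b]repr_wordK.
rewrite [(class_of _ _ * _)%g]presented_mulE !presented_map_class map_cat.
by rewrite [RHS]presented_mulE.
Qed.

HB.instance Definition _ :=
  isMultiplicative.Build _ _ presented_map presented_map_mul.

Definition presented_morphism :
  {multiplicative presented relX -> presented relY} := presented_map.

Lemma presented_morphism_surj :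
  (forall y, exists x, g x = y) -> forall b, exists a, presented_morphism a = b.
Proof.
move=> /choice[h gh] b.
exists (class_of relX [seq (h p.1, p.2) | p <- repr_word b]).
rewrite [LHS]presented_map_class -[b in RHS]repr_wordK -map_comp.
congr class_of; rewrite -[RHS]map_id.
by apply: eq_map => -[y e]; rewrite /letter_map /= gh.
Qed.

End PresentedMap.

(** * Simplices of the nerve are chains of cones *)

Section Chains.
Set Implicit Arguments.
Unset Strict Implicit.
Local Open Scope classical_set_scope.
Variables (R : realType) (n : nat) (S : fan R n) (P : admissible_partition S).
Local Notation cone := (set 'rV[R]_n).

Lemma block_of_block b (s : cone) : blocks P b -> b s -> block_of P s = b.
Proof.
by move=> Pb bs; apply/seteqP; split=> t /(sim_block _ Pb bs).
Qed.

Lemma blocks_block_of (s : cone) : cones S s -> blocks P (block_of P s).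
Proof.
move=> /(sim_refl P)[b Pb [bs _]].
by rewrite (block_of_block Pb bs).
Qed.

Definition cone_obj (s : cone) (Ss : cones S s) : fan_obj P :=
  exist _ (block_of P s) (blocks_block_of Ss).

Lemma cone_obj_self (s : cone) (Ss : cones S s) : sval (cone_obj Ss) s.
Proof. exact: sim_refl. Qed.

(** The pair (s, t) itself belongs to the class of f_{s t'}, so t and t' have the
    same projection along s, and this projection is injective on the star of s.
    Both faithfulness and the description of simplices rest on this. *)
Lemma mor_class_target_inj (s t t' : cone) :
  star S s t -> star S s t' -> cones S s ->
  mor_class P s t = mor_class P s t' -> t = t'.
Proof.
move=> st st' Ss e; apply: (star_proj_inj Ss st st').
have := mor_class_refl P Ss st.1 st.2.
by rewrite e => -[].
Qed.

(** Objects and morphisms of the category are sets with a proof attached, so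
    comparing the sets avoids transporting morphisms along equalities of
    objects. *)
Lemma fan_functor_eq (C : category) (x y : functor C (fan_category P)) :
  (forall a, sval (x a) = sval (y a)) ->
  (forall a b (f : Defs.hom a b), sval (Defs.fmap x f) = sval (Defs.fmap y f)) ->
  x = y.
Proof.
case: x y => [ox m i c] [oy m' i' c'] /= eo em.
have oo : ox = oy by apply/funext => a; apply: eq_sig_hprop => // *; exact: eo.
subst oy.
have mm : m = m'.
  apply/functional_extensionality_dep => a.
  apply/functional_extensionality_dep => b.
  by apply/funext => f; apply: fan_hom_eq; exact: em.
subst m'.
by congr Functor; exact: Prop_irrelevance.
Qed.

Section ChainFunctor.
Variables (k : nat) (s : 'I_k.+1 -> cone).
Hypothesis s_cone : forall i, cones S (s i).
Hypothesis s_mono : forall i j : 'I_k.+1, (i <= j)%N -> s i `<=` s j.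

Definition chain_fmap (i j : obj (ord_cat k)) (ij : Defs.hom i j) :
    fan_hom (cone_obj (s_cone i)) (cone_obj (s_cone j)) :=
  fan_mor (cone_obj_self (s_cone i)) (cone_obj_self (s_cone j)) (s_mono ij).

Lemma chain_fmap_id i : chain_fmap (idc i) = fan_id (cone_obj (s_cone i)).
Proof. by rewrite (fan_id_mor (cone_obj_self _)); exact: fan_hom_eq. Qed.

Lemma chain_fmap_comp (i j l : obj (ord_cat k)) (jl : Defs.hom j l)
    (ij : Defs.hom i j) :
  chain_fmap (compose jl ij) = fan_comp (chain_fmap jl) (chain_fmap ij).
Proof. by rewrite fan_comp_mor; exact: fan_hom_eq. Qed.

Definition chain_functor : functor (ord_cat k) (fan_category P) :=
  @Functor (ord_cat k) (fan_category P) (fun i => cone_obj (s_cone i))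
    chain_fmap chain_fmap_id chain_fmap_comp.

End ChainFunctor.

(** A simplex is determined by its first cone and its morphisms out of the first
    vertex. Writing these as f_{s0 s_i}, the morphism from vertex i to vertex j is
    f_{s_i t} for some t; composing with f_{s0 s_i} gives f_{s0 t}, which is also
    f_{s0 s_j}, and [mor_class_target_inj] yields t = s_j. *)
Lemma nerve_chain k (x : functor (ord_cat k) (fan_category P)) :
  exists (s : 'I_k.+1 -> cone) (s_cone : forall i, cones S (s i))
    (s_mono : forall i j : 'I_k.+1, (i <= j)%N -> s i `<=` s j),
    x = chain_functor s_cone s_mono.
Proof.
have [s0 s0x] := fan_obj_inhab (x (ord0 : 'I_k.+1)).
have Ss0 : cones S s0 := obj_cone s0x.
have /choice[s sP] (i : 'I_k.+1) : exists t : cone, [/\ sval (x i) t, s0 `<=` t &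
    sval (Defs.fmap x (leq0n i : @Defs.hom (ord_cat k) ord0 i)) = mor_class P s0 t].
  have [t [tx [? [s0t xE]]]] :=
    fan_hom_repr (Defs.fmap x (leq0n i : @Defs.hom (ord_cat k) ord0 i)) s0x.
  by exists t; rewrite xE.
have s_cone i : cones S (s i) by have [sx _ _] := sP i; exact: obj_cone sx.
have step (i j : 'I_k.+1) (ij : (i <= j)%N) : s i `<=` s j /\
    sval (Defs.fmap x (ij : @Defs.hom (ord_cat k) i j)) = mor_class P (s i) (s j).
  have [six s0si iE] := sP i; have [sjx s0sj jE] := sP j.
  have [t [tx [six' [sit xE]]]] :=
    fan_hom_repr (Defs.fmap x (ij : @Defs.hom (ord_cat k) i j)) six.
  suff -> : s j = t by rewrite xE.
  have s0t := subset_trans s0si sit.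
  apply: (@mor_class_target_inj s0) => //; first by split; [exact: obj_cone tx|].
  rewrite -jE.
  have -> : leq0n j = compose (ij : @Defs.hom (ord_cat k) i j)
      (leq0n i : @Defs.hom (ord_cat k) ord0 i) by exact: bool_irrelevance.
  rewrite Defs.fmap_comp xE.
  have -> : Defs.fmap x (leq0n i : @Defs.hom (ord_cat k) ord0 i) =
      fan_mor s0x six s0si by exact: fan_hom_eq.
  by rewrite /= (Prop_irrelevance six' six) fan_comp_setE.
exists s, s_cone, (fun i j ij => (step i j ij).1).
apply: fan_functor_eq => [i|i j ij] /=; last exact: (step i j ij).2.
have [six _ _] := sP i.
by rewrite (block_of_block (svalP (x i)) six).
Qed.

End Chains.

(** * Passing to a coarser partition *)

Section Coarsening.
Set Implicit Arguments.
Unset Strict Implicit.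
Local Open Scope classical_set_scope.
Variables (R : realType) (n : nat) (S : fan R n) (P1 P2 : admissible_partition S).
Hypothesis P12 : finer P1 P2.
Local Notation cone := (set 'rV[R]_n).

Definition coarse_block (b : set cone) : set cone :=
  [set t | exists2 s, b s & same_block P2 s t].

Lemma coarse_blockE (s : cone) : cones S s ->
  coarse_block (block_of P1 s) = block_of P2 s.
Proof.
move=> Ss; apply/seteqP; split=> [t [u su ut]|t st].
  exact: sim_trans (P12 su) ut.
by exists s => //; exact: sim_refl.
Qed.

Lemma blocks_coarse_block b : blocks P1 b -> blocks P2 (coarse_block b).
Proof.
move=> P1b; have [s bs] := fan_obj_inhab (exist _ b P1b : fan_obj P1).
have Ss := obj_cone bs.
rewrite -(block_of_block P1b bs) coarse_blockE //.
exact: blocks_block_of.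
Qed.

Definition coarse_obj (a : fan_obj P1) : fan_obj P2 :=
  exist _ (coarse_block (sval a)) (blocks_coarse_block (svalP a)).

Lemma coarse_obj_sub (a : fan_obj P1) s : sval a s -> sval (coarse_obj a) s.
Proof. by move=> sa; exists s => //; exact/sim_refl/obj_cone/sa. Qed.

(** Union of the P2-classes of all pairs in m; when m is a P1-class they all
    coincide ([coarse_morE]). Taking the union avoids choosing a
    representative. *)
Definition coarse_mor (m : set (cone * cone)) : set (cone * cone) :=
  [set p | exists2 q, m q & mor_class P2 q.1 q.2 p].

(** Equal P1-classes mean P1-equivalent ends and equal projections, and both
    persist for P2. *)
Lemma finer_mor_class (s1 t1 s2 t2 : cone) :
  cones S s2 -> cones S t2 -> s2 `<=` t2 ->
  mor_class P1 s1 t1 = mor_class P1 s2 t2 ->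
  mor_class P2 s1 t1 = mor_class P2 s2 t2.
Proof.
move=> Ss2 St2 st2 e; have := mor_class_refl P1 Ss2 St2 st2.
by rewrite -e => -[/= s12 t12 _ /esym]; apply: mor_class_eq; exact: P12.
Qed.

Lemma coarse_morE (s t : cone) : cones S s -> cones S t -> s `<=` t ->
  coarse_mor (mor_class P1 s t) = mor_class P2 s t.
Proof.
move=> Ss St st; apply/seteqP; split=> [p [[s' t'] [/= ss tt _ e]]|p stp].
  by rewrite (mor_class_eq (P12 ss) (P12 tt) (esym e)).
by exists (s, t) => //; exact: mor_class_refl.
Qed.

Lemma coarse_fmap_subproof (a b : fan_obj P1) (f : fan_hom a b) :
  exists s t, [/\ sval (coarse_obj a) s, sval (coarse_obj b) t, s `<=` t
                 & coarse_mor (sval f) = mor_class P2 s t].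
Proof.
have [s [t [sa tb st ->]]] := svalP f.
exists s, t; split=> //; try exact: coarse_obj_sub.
by rewrite coarse_morE //; [exact: obj_cone sa|exact: obj_cone tb].
Qed.

Definition coarse_fmap (a b : fan_obj P1) (f : fan_hom a b) :
    fan_hom (coarse_obj a) (coarse_obj b) :=
  exist _ (coarse_mor (sval f)) (coarse_fmap_subproof f).

Lemma coarse_fmap_mor (a b : fan_obj P1) s t (sa : sval a s) (tb : sval b t)
    (st : s `<=` t) :
  coarse_fmap (fan_mor sa tb st) =
  fan_mor (coarse_obj_sub sa) (coarse_obj_sub tb) st.
Proof.
apply: fan_hom_eq; rewrite /= coarse_morE //.
  exact: obj_cone sa.
exact: obj_cone tb.
Qed.

Lemma coarse_fmap_id a : coarse_fmap (fan_id a) = fan_id (coarse_obj a).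
Proof.
have [s sa] := fan_obj_inhab a.
by rewrite (fan_id_mor sa) coarse_fmap_mor (fan_id_mor (coarse_obj_sub sa)).
Qed.

Lemma coarse_fmap_comp a b c (g : fan_hom b c) (f : fan_hom a b) :
  coarse_fmap (fan_comp g f) = fan_comp (coarse_fmap g) (coarse_fmap f).
Proof.
have [s sa] := fan_obj_inhab a; have [t [tb [sa' [st ->]]]] := fan_hom_repr f sa.
have [k [kc [tb' [tk ->]]]] := fan_hom_repr g tb.
rewrite (Prop_irrelevance tb' tb) fan_comp_mor !coarse_fmap_mor fan_comp_mor.
exact: fan_hom_eq.
Qed.

Definition coarsening : functor (fan_category P1) (fan_category P2) :=
  @Functor (fan_category P1) (fan_category P2) coarse_obj coarse_fmap
    coarse_fmap_id coarse_fmap_comp.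

(** Once two parallel morphisms are written with the same source s, their
    P2-classes already determine the target cone. *)
Lemma coarsening_faithful : faithful coarsening.
Proof.
move=> a b f g; have [s sa] := fan_obj_inhab a.
have [t [tb [sa' [st ->]]]] := fan_hom_repr f sa.
have [t' [tb' [sa'' [st' ->]]]] := fan_hom_repr g sa.
rewrite /= !coarse_fmap_mor => /(congr1 sval) /= e.
apply: fan_hom_eq; congr mor_class.
apply: (mor_class_target_inj _ _ _ e); [split=> //|split=> //|].
- exact: obj_cone tb.
- exact: obj_cone tb'.
- exact: obj_cone sa.
Qed.

Lemma coarsening_surj : surjective_on_objects coarsening.
Proof.
move=> d; have [s sd] := fan_obj_inhab d; have Ss := obj_cone sd.
exists (cone_obj P1 Ss); apply: eq_sig_hprop => //=.
by rewrite coarse_blockE //; exact: block_of_block (svalP d) sd.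
Qed.

(** The vertices and edges of the two simplices are computed from the same
    cones. *)
Lemma coarsening_chain k (s : 'I_k.+1 -> cone) (s_cone : forall i, cones S (s i))
    (s_mono : forall i j : 'I_k.+1, (i <= j)%N -> s i `<=` s j) :
  comp_functor coarsening (chain_functor P1 s_cone s_mono) =
  chain_functor P2 s_cone s_mono.
Proof.
apply: fan_functor_eq => [i|i j ij] /=; first exact: coarse_blockE.
by rewrite coarse_morE //; exact: s_mono.
Qed.

Definition coarse_simplex k : nerve (fan_category P1) k -> nerve (fan_category P2) k :=
  comp_functor coarsening.

Lemma coarse_simplex_natural k l (f : functor (ord_cat l) (ord_cat k))
    (x : nerve (fan_category P1) k) :
  coarse_simplex (sact f x) = sact f (coarse_simplex x).
Proof. exact: fan_functor_eq. Qed.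

(** A simplex for P2 is the simplex of a chain of cones, and the same chain
    defines a simplex for P1. *)
Lemma coarse_simplex_surj k (y : nerve (fan_category P2) k) :
  exists x, coarse_simplex x = y.
Proof.
have [s [s_cone [s_mono ->]]] := nerve_chain y.
by exists (chain_functor P1 s_cone s_mono); exact: coarsening_chain.
Qed.

(** * Picture groups *)

Section PictureGroups.
Variable Q : weak_fan_poset S.

Lemma coarse_gen_subproof (x : picture_gen P1) :
  blocks P2 (coarse_block (sval x)) /\
  exists2 s, coarse_block (sval x) s & (cdim s).+1 = n.
Proof.
have [P1x [s xs sn]] := svalP x; split; first exact: blocks_coarse_block.
exists s => //.
exact: (coarse_obj_sub (xs : sval (exist _ _ P1x : fan_obj P1) s)).
Qed.

Definition coarse_gen (x : picture_gen P1) : picture_gen P2 :=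
  exist _ (coarse_block (sval x)) (coarse_gen_subproof x).

Lemma coarse_gen_surj y : exists x, coarse_gen x = y.
Proof.
have [P2y [s ys sn]] := svalP y.
have Ss : cones S s := obj_cone (ys : sval (exist _ _ P2y : fan_obj P2) s).
have xP : blocks P1 (block_of P1 s) /\
    exists2 t, block_of P1 s t & (cdim t).+1 = n.
  by split; [exact: blocks_block_of|exists s => //; exact: sim_refl].
exists (exist _ (block_of P1 s) xP); apply: eq_sig_hprop => //=.
by rewrite coarse_blockE //; exact: block_of_block.
Qed.

(** The label sequence of a chain is made of cones, independent of the partition;
    only the generators attached to the labels change. *)
Lemma spells_coarse (w : seq (picture_gen P1)) l :
  spells w l -> spells (map coarse_gen w) l.
Proof.
rewrite /spells; elim: l w => [|s l IH] [|x w] //= [xs /IH ->].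
rewrite xs coarse_blockE //.
have [P1x [t xt _]] := svalP x.
have := xt; rewrite xs => /sim_cone.
exact.
Qed.

Lemma chain_word_coarse t1 t2 (w : seq (picture_gen P1)) :
  chain_word Q t1 t2 w -> chain_word Q t1 t2 (map coarse_gen w).
Proof. by move=> [l tl wl]; exists l => //; exact: spells_coarse. Qed.

(** The endpoints s^- and k^- in the second family of relations depend on the fan
    and the poset alone, so only the equality of morphism classes has to be
    transferred to P2. *)
Lemma picture_rel_coarse (w w' : seq (picture_gen P1)) :
  picture_rel Q w w' -> picture_rel Q (map coarse_gen w) (map coarse_gen w').
Proof.
case=> {w w'} [t1 t2 w w' tw tw'|].
  exact: (picture_chain (chain_word_coarse tw) (chain_word_coarse tw')).
move=> s1 k1 s2 k2 s1m k1m s2m k2m w w' sk1 sk2 Ss1 Ss2 e m1 m1' m2 m2' cw cw'.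
apply: (picture_mor sk1 sk2 Ss1 Ss2 _ m1 m1' m2 m2'); try exact: chain_word_coarse.
by case: sk2 => Sk2 sk2; exact: finer_mor_class.
Qed.

End PictureGroups.
End Coarsening.

Theorem theorem1p3 (R : realType) (n : nat) (S : fan R n)
    (Q : weak_fan_poset S) (P1 P2 : admissible_partition S)
    (P12 : finer P1 P2) :
  (exists F : functor (fan_category P1) (fan_category P2),
     faithful F /\ surjective_on_objects F) /\
  (exists q : classifying_space R (fan_category P1) ->
              classifying_space R (fan_category P2), quotient_map q) /\
  (exists f : {multiplicative picture_group P1 Q -> picture_group P2 Q},
     forall y, exists x, f x = y).
Proof.
split; [|split].
- by exists (coarsening P12); split;
    [exact: coarsening_faithful|exact: coarsening_surj].
- exists (@realisation_map R _ _ (coarse_simplex P12)).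
  apply: realisation_map_quotient; first exact: coarse_simplex_natural.
  exact: coarse_simplex_surj.
- exists (presented_morphism (picture_rel_coarse P12 (Q:=Q))).
  exact: presented_morphism_surj (coarse_gen_surj P12).
Qed.
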